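(* Let $\mathcal{P}\in\mathcal{Q}_n$ be a sign nonsingular sign pattern with signed directed graph $D$. If $\mathcal{P}\in\Delta$, then: (1) all composite cycles of length $n$ in $D$ have the same sign; (2) $D$ contains either a negative even cycle or at least two vertex-disjoint nonzero odd cycles; (3) if $D$ has a negative even cycle, then $D$ does not have two vertex-disjoint nonzero odd cycles of the same sign; (4) if $D$ has a composite cycle $\Gamma$ of length $n$ that contains an odd cycle $\gamma$, then every odd cycle in $D(V(\gamma))$ has the same sign as $\gamma$.
   Context: A sign pattern is a matrix with entries in $\{+,-,0\}$; $\mathcal{Q}_n$ is the set of $n\times n$ sign patterns; $\mathcal{Q}(\mathcal{P})$ is the set of real matrices whose entries have the signs prescribed by $\mathcal{P}$. $\mathcal{P}$ is sign nonsingular if every matrix in $\mathcal{Q}(\mathcal{P})$ is nonsingular. $\Delta$ is the class of all sign patterns $\mathcal{P}$ for which every $A\in\mathcal{Q}(\mathcal{P})$ has exactly two real eigenvalues (with algebraic multiplicity). The signed directed graph $D$ of $\mathcal{P}=[p_{ij}]$ has vertices $1,\dots,n$ and arc $(i,j)$ (loops allowed) iff $p_{ij}\neq0$. A (nonzero) simple cycle $\gamma=(i_1,\dots,i_k)$ has distinct vertices with $p_{i_1i_2},\dots,p_{i_ki_1}$ nonzero, length $k$ (even/odd accordingly), vertex set $V(\gamma)=\{i_1,\dots,i_k\}$, and sign $(-1)^{k-1}p_{i_1i_2}\cdots p_{i_ki_1}$. A composite cycle is a product of mutually vertex-disjoint simple cycles; its length is the sum of their lengths and its sign the product of their signs. For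 $S\subseteq\{1,\dots,n\}$, $D(S)$ is the subgraph of $D$ induced by $S$. *)

(* Defs.v *)
From mathcomp Require Import all_boot all_order all_algebra.
From mathcomp Require Import all_real_closed.
From mathcomp Require Import reals.

Set Implicit Arguments.
Unset Strict Implicit.
Unset Printing Implicit Defensive.

Import Order.TTheory GRing.Theory Num.Theory.
Local Open Scope ring_scope.

Inductive sign := Plus | Minus | Zero.

Definition sign_int (s : sign) : int :=
  match s with Plus => 1 | Minus => -1 | Zero => 0 end.

Definition qual_class (R : realType) n (P : 'M[sign]_n) (A : 'M[R]_n) : Prop :=
  forall i j, sgz (A i j) = sign_int (P i j).

Definition sign_nonsingular (R : realType) n (P : 'M[sign]_n) : Prop :=
  forall A : 'M[R]_n, qual_class P A -> A \in unitmx.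

(* Algebraic multiplicities are the multiplicities as roots of char_poly A;
   rootsR lists each real root once. *)
Definition num_real_eigenvalues (R : realType) n (A : 'M[R]_n) : nat :=
  (\sum_(x <- rootsR (char_poly A)) mup x (char_poly A))%N.

Definition in_Delta (R : realType) n (P : 'M[sign]_n) : Prop :=
  forall A : 'M[R]_n, qual_class P A -> num_real_eigenvalues A = 2%N.

(* The signed digraph of P is this relation on 'I_n, the arc (i, j)
   carrying the sign P i j. *)
Definition digraph n (P : 'M[sign]_n) : rel 'I_n :=
  [rel i j | sign_int (P i j) != 0].

Definition induced n (S : {set 'I_n}) (e : rel 'I_n) : rel 'I_n :=
  [rel i j | [&& i \in S, j \in S & e i j]].

(* A simple cycle (i_1, ..., i_k) is given by its vertex sequence, up to
   rotation; ucycleb also tests the closing arc (i_k, i_1), so k = 1 is a loop.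
   The length is the size of the sequence. *)
Definition simple_cycle n (e : rel 'I_n) (c : seq 'I_n) : bool :=
  (c != [::]) && ucycleb e c.

Definition cycle_sign n (P : 'M[sign]_n) (c : seq 'I_n) : int :=
  (-1) ^+ (size c).-1 * \prod_(i <- c) sign_int (P i (next c i)).

Definition composite_cycle n (e : rel 'I_n) (G : seq (seq 'I_n)) : bool :=
  all (simple_cycle e) G && pairwise (fun c d : seq 'I_n => [disjoint c & d]) G.

Definition composite_length n (G : seq (seq 'I_n)) : nat :=
  (\sum_(c <- G) size c)%N.

Definition composite_sign n (P : 'M[sign]_n) (G : seq (seq 'I_n)) : int :=
  \prod_(c <- G) cycle_sign P c.

Definition odd_cycle n (e : rel 'I_n) (c : seq 'I_n) : bool :=
  simple_cycle e c && odd (size c).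

Definition negative_even_cycle n (P : 'M[sign]_n) (c : seq 'I_n) : bool :=
  [&& simple_cycle (digraph P) c, ~~ odd (size c) & cycle_sign P c == -1].

(* Main.v *)
(* Every composite cycle carries a subpattern of [P] whose characteristic
   polynomial factors: giving weight [w_c] to the arcs of each cycle [c] of [G],
   [x^|G| chi(x) = x^n prod_c (x^|c| + sgn c (- w_c)^|c|)].  A small perturbation
   lies in the qualitative class of [P] and keeps the sign of [chi] at any
   finitely many points where it is nonzero; moreover [n] is even, so
   [chi(0) = det], whose sign is the same on the whole class; this gives (1).
   Each violation of (3) or (4) yields a weighting for which [chi] changes sign
   three times, hence three real eigenvalues, and a violation of (2) one for
   which [chi >= 1] everywhere, hence no real eigenvalue. *)

Require Import Defs.
From mathcomp Require Import all_boot all_order all_algebra.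
From mathcomp Require Import all_real_closed.
From mathcomp Require Import reals.
From mathcomp Require Import perm ring lra.

Set Implicit Arguments.
Unset Strict Implicit.
Unset Printing Implicit Defensive.

Import Order.TTheory GRing.Theory Num.Theory.
Local Open Scope ring_scope.

(** * Characteristic polynomials of matrices supported on disjoint cycles *)

Section CycleMatrix.
Variable n : nat.
Implicit Types (c : seq 'I_n) (G : seq (seq 'I_n)).

Lemma next_id (T : eqType) (c : seq T) x : x \notin c -> next c x = x.
Proof. by case: c => [//|y c] xNc; rewrite next_nth (negbTE xNc). Qed.

(** A duplicate-free cycle is a single orbit of [next c], so a property preserved along the arcs
    spreads from one vertex to all. *)
Lemma next_closed c (p : pred 'I_n) i :
  uniq c -> i \in c -> p i -> (forall j, j \in c -> p j -> p (next c j)) ->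
  forall j, j \in c -> p j.
Proof.
move=> Uc ci pi pS j cj.
have : fconnect (next c) i j by rewrite (fconnect_cycle (cycle_next Uc) ci).
move/iter_findex <-; set m := findex _ _ _.
suff /andP[] : (iter m (next c) i \in c) && p (iter m (next c) i) by [].
elim: m => [|m /andP[cm pm]] /=; first by rewrite ci.
by rewrite mem_next cm pS.
Qed.

Lemma next_neq c i : uniq c -> (1 < size c)%N -> i \in c -> next c i != i.
Proof.
move=> Uc c_gt1 ci; apply: contraTneq c_gt1 => ni.
rewrite -leqNgt -[1%N]/(size [:: i]); apply: uniq_leq_size => // j cj.
rewrite inE; apply: (next_closed (p := pred1 i) Uc ci) => //=.
by move=> k _ /eqP->; rewrite ni.
Qed.

Definition cycle_mx (T : pzRingType) (A : 'M[T]_n) c : 'M[T]_n :=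
  \matrix_(i, j) (A i j *+ ((i \in c) && (j == next c i))).

Definition weight (T : pzRingType) (A : 'M[T]_n) c : T :=
  \prod_(i <- c) A i (next c i).

Lemma weight_prod (T : comPzRingType) (A : 'M[T]_n) c :
  uniq c -> weight A c = \prod_(i in c) A i (next c i).
Proof. by move=> Uc; rewrite /weight big_uniq. Qed.

(** As [next c] fixes the vertices outside [c], it permutes all of ['I_n] and can index a term of
    the Leibniz expansion. *)
Definition next_perm c (Uc : uniq c) : 'S_n := perm (can_inj (prev_next Uc)).

Lemma size_uniqC c : uniq c -> (size c + #|[predC c]|)%N = n.
Proof. by move=> Uc; have := cardC (mem c); rewrite (card_uniqP Uc) card_ord. Qed.

Lemma size_uniq_le c : uniq c -> (size c <= n)%N.
Proof. by move=> Uc; rewrite -[leqRHS](size_uniqC Uc) leq_addr. Qed.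

(** A Leibniz term can be nonzero only if its permutation sends each vertex to itself or along the
    cycle, and moving one vertex of the cycle forces moving all of them. So only the identity and
    [next_perm] survive; the length bound makes them distinct. *)
Lemma det_cycle_terms (T : comNzRingType) (x : T) (A : 'M[T]_n) c (Uc : uniq c) :
  (1 < size c)%N ->
  \det (x%:M - cycle_mx A c) =
  x ^+ n + (-1) ^+ next_perm Uc * ((-1) ^+ size c * weight A c * x ^+ (n - size c)).
Proof.
move=> c_gt1; rewrite /determinant (bigD1 (1%g : 'S_n)) //= (bigD1 (next_perm Uc)) /=; last first.
  case: c Uc c_gt1 => [//|i0 c] Uc c_gt1.
  apply/eqP => /permP/(_ i0); rewrite permE perm1.
  by apply/eqP/next_neq => //; rewrite mem_head.
rewrite [X in _ + (_ + X)]big1 ?addr0 => [|s /andP[sN1 sNc]]; last first.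
  have [sB|] := boolP [forall i, (s i == i) || (i \in c) && (s i == next c i)]; last first.
    rewrite negb_forall; case/existsP=> i; rewrite negb_or => /andP[/negbTE si sci].
    by rewrite (bigD1 i) //= !mxE eq_sym si (negbTE sci) subrr mul0r mulr0.
  exfalso; move/forallP in sB.
  have [i si] : exists i, s i != i.
    apply/existsP; rewrite -negb_forall; apply: contra sN1 => /forallP s1.
    by apply/eqP/permP => i; rewrite perm1 (eqP (s1 i)).
  have ci : i \in c by have := sB i; rewrite (negbTE si) => /andP[].
  (* If [s j = next c j] and [s] fixed [next c j], injectivity would give [next c j = j], so [s]
     would fix [j]. *)
  have moved : forall j, j \in c -> s j != j.
    apply: (next_closed (p := fun j => s j != j) Uc ci si) => j cj sj.
    have := sB j; rewrite (negbTE sj) cj /= => /eqP snj.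
    by apply: contra sj => /eqP; rewrite -{2}snj => /perm_inj nj; rewrite snj nj.
  case/negP: sNc; apply/eqP/permP => j; rewrite permE.
  have := sB j; case: (boolP (j \in c)) => [cj|cNj].
    by rewrite (negbTE (moved j cj)) => /eqP.
  by rewrite orbF next_id // => /eqP.
congr (_ + _).
  rewrite odd_perm1 expr0 mul1r (eq_bigr (fun=> x)) ?prodr_const ?card_ord // => i _.
  rewrite !mxE perm1 eqxx; case: (boolP (i \in c)) => ci; last by rewrite subr0.
  by rewrite eq_sym (negbTE (next_neq Uc c_gt1 ci)) subr0.
congr (_ * _); rewrite (bigID (mem c)) /=; congr (_ * _).
  rewrite weight_prod // -(card_uniqP Uc) -prodrN.
  apply: eq_bigr => i ci; rewrite !mxE permE ci eqxx /=.
  by rewrite eq_sym (negbTE (next_neq Uc c_gt1 ci)) sub0r.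
rewrite (eq_bigr (fun=> x)) => [|i cNi]; last first.
  by rewrite !mxE permE (negbTE cNi) subr0 next_id // eqxx.
rewrite prodr_const; congr (_ ^+ _).
apply: (@addnI (size c)); rewrite subnKC ?size_uniq_le // -[RHS](size_uniqC Uc).
by congr (_ + _)%N; apply: eq_card.
Qed.

Lemma det_cycle_mx1 (F : fieldType) c :
  uniq c -> c != [::] -> \det (1%:M - cycle_mx (const_mx 1) c) = 0 :> F.
Proof.
(* [det0P] expects a row vector acting on the left, whereas the indicator of the cycle is killed
   from the right; hence the transpose. *)
move=> Uc; case: c Uc => [//|k c] Uc _; rewrite -det_tr; apply/eqP/det0P.
exists (\row_j (j \in k :: c)%:R).
  by apply/eqP => /rowP/(_ k)/eqP; rewrite !mxE mem_head oner_eq0.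
apply/rowP => i; rewrite !mxE.
transitivity (\sum_j ((j == i)%:R * (i \in k :: c)%:R
                     - (j == next (k :: c) i)%:R * (i \in k :: c)%:R : F)); last first.
  have sum1 k0 : \sum_j (j == k0)%:R = 1 :> F.
    by rewrite (bigD1 k0) //= eqxx big1 ?addr0 // => j /negbTE->.
  by rewrite sumrB -!mulr_suml !sum1 subrr.
apply: eq_bigr => j _; rewrite !mxE [j == i]eq_sym mulrBr; congr (_ - _).
  by have [->|_] := eqVneq; rewrite ?mulr1 ?mul1r ?mulr0 ?mul0r.
have [->|_] := eqVneq; last by rewrite andbF mulr0 mul0r.
rewrite mem_next andbT.
by case: (i \in _); rewrite ?mulr0 ?mulr1.
Qed.

(* The all-one cycle matrix fixes the indicator vector of the cycle, so its
   determinant expansion, which has only two terms, vanishes at [x = 1]. *)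
Lemma odd_next_perm c (Uc : uniq c) :
  (1 < size c)%N -> next_perm Uc = ~~ odd (size c) :> bool.
Proof.
move=> c_gt1.
have := det_cycle_terms (1 : rat) (const_mx 1) Uc c_gt1.
rewrite det_cycle_mx1 //; last by case: (c) c_gt1.
rewrite /weight big1 => [|i _]; last by rewrite mxE.
rewrite !expr1n !mulr1 => /eqP; rewrite -[(-1) ^+ size c]signr_odd.
by case: (odd_perm _); case: (odd _).
Qed.

(** For length [k > 1] the permutation sign [(-1)^(k-1)] meets [(-1)^k] and leaves [-1]; a loop
    gives a diagonal matrix and is computed directly. Powers of [x] on both sides avoid the exponent
    [n - size c]. *)
Lemma det_cycle_mx (T : comNzRingType) (x : T) (A : 'M[T]_n) c :
  uniq c -> c != [::] ->
  x ^+ size c * \det (x%:M - cycle_mx A c) = x ^+ n * (x ^+ size c - weight A c).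
Proof.
move=> Uc c_neq0.
have c_len := size_uniq_le Uc.
have [|c_gt1|c1] := ltngtP (size c) 1; first by rewrite ltnS leqn0 size_eq0 (negbTE c_neq0).
  rewrite (det_cycle_terms x A Uc) // odd_next_perm // -[(-1) ^+ size c]signr_odd.
  have sgn (b : bool) : (-1) ^+ (~~ b) * (-1) ^+ b = -1 :> T.
    by case: b; rewrite ?mul1r ?mulr1.
  rewrite !(mulrA _ _ (x ^+ (n - _))) (mulrA ((-1) ^+ _)) sgn mulN1r mulNr.
  by rewrite !mulrBr -[n in x ^+ n * weight _ _](subnKC c_len) exprD; ring.
have /eqP := c1; case: c c_neq0 Uc c_len c1 => [//|i [|//]] _ _ _ _ _.
have next1 j : next [:: i] j = j by rewrite /=; case: eqP.
have Cjk j k : (x%:M - cycle_mx A [:: i]) j k =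
    x *+ (j == k) - A i i *+ ((j == i) && (k == i)).
  rewrite !mxE inE next1; have [->|//] := eqVneq j i.
  by have [->|//] := eqVneq k i.
rewrite det_trig; last first.
  apply/is_trig_mxP => j k jk; rewrite Cjk -val_eqE (ltn_eqF jk) sub0r.
  by have [<-|_] := eqVneq j i; rewrite ?oppr0 //= -val_eqE (gtn_eqF jk) oppr0.
rewrite (bigD1 i) //= Cjk !eqxx (eq_bigr (fun=> x)) => [|j ji]; last first.
  by rewrite Cjk eqxx (negbTE ji) subr0.
rewrite prodr_const cardC1 card_ord /weight big_seq1 next1 !expr1.
by rewrite mulrCA -exprS mulrC prednK // (leq_ltn_trans _ (ltn_ord i)).
Qed.

(** When [A *m B = 0], the product of [x - A] and [x - B] collapses to [x] times [x - (A + B)]. *)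
Lemma det_scalar_sub_orth (T : comNzRingType) (x : T) (A B : 'M[T]_n) :
  A *m B = 0 ->
  \det (x%:M - A) * \det (x%:M - B) = x ^+ n * \det (x%:M - (A + B)).
Proof.
move=> AB0; rewrite -det_mulmx -detZ; congr (\det _).
rewrite mulmxBl [A *m _]mulmxBr AB0 subr0 mul_scalar_mx mul_mx_scalar -scalerBr.
by rewrite opprD addrA addrAC.
Qed.

Definition composite_mx (T : pzRingType) (w : seq 'I_n -> T) (A : 'M[T]_n) G : 'M[T]_n :=
  \sum_(c <- G) w c *: cycle_mx A c.

(** The part of being a composite cycle that does not refer to a digraph; it suffices for the
    determinant formula over any matrix. *)
Definition disjoint_cycles G :=
  all (fun c => (c != [::]) && uniq c) G && pairwise (fun c d => [disjoint c & d]) G.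

Lemma cycle_mx_orth (T : comPzRingType) (A B : 'M[T]_n) c d :
  [disjoint c & d] -> cycle_mx A c *m cycle_mx B d = 0.
Proof.
move=> cd; apply/matrixP => i j; rewrite !mxE big1 // => k _; rewrite !mxE.
case: (boolP (i \in c)) => /= [ci|]; last by rewrite mul0r.
have [->|] := eqVneq k (next c i); last by rewrite mul0r.
by rewrite (disjointFr cd) ?mem_next //= mulr0.
Qed.

(** Induction on [G]: matrices of disjoint cycles multiply to zero, so the determinants multiply up
    to a factor [x ^+ n], which [x != 0] allows to cancel. *)
Lemma det_composite_mx (T : idomainType) (x : T) (w : seq 'I_n -> T) (A : 'M[T]_n) G :
  x != 0 -> disjoint_cycles G ->
  x ^+ composite_length G * \det (x%:M - composite_mx w A G) =
  x ^+ n * \prod_(c <- G) (x ^+ size c - w c ^+ size c * weight A c).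
Proof.
rewrite /composite_length /composite_mx => x_neq0.
elim: G => [_|c G IH]; first by rewrite !big_nil subr0 det_scalar mul1r mulr1.
move=> /andP[/= /andP[/andP[c_neq0 Uc] Gc] /andP[cG Gp]].
have{}IH := IH (introT andP (conj Gc Gp)).
have wc : w c *: cycle_mx A c = cycle_mx (w c *: A) c.
  by apply/matrixP => i j; rewrite !mxE mulrnAr.
have weight_c : w c ^+ size c * weight A c = weight (w c *: A) c.
  rewrite !weight_prod // -(card_uniqP Uc) -prodrMl.
  by apply: eq_bigr => i _; rewrite mxE.
rewrite !big_cons; set B := \sum_(d <- G) _ in IH *.
apply: (mulfI (expf_neq0 n x_neq0)); rewrite mulrCA -det_scalar_sub_orth; last first.
  rewrite wc mulmx_sumr big_seq big1 // => d dG; rewrite -scalemxAr cycle_mx_orth ?scaler0 //.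
  exact: (allP cG).
by rewrite exprD mulrACA IH wc det_cycle_mx // weight_c mulrACA -!mulrA.
Qed.

(** The determinant formula is applied over polynomials at the nonzero element ['X], which yields an
    identity that can be evaluated anywhere, [0] included. *)
Lemma char_poly_composite_mx (T : idomainType) (w : seq 'I_n -> T) (A : 'M[T]_n) G :
  disjoint_cycles G ->
  'X^(composite_length G) * char_poly (composite_mx w A G) =
  'X^n * \prod_(c <- G) ('X^(size c) - (w c ^+ size c * weight A c)%:P).
Proof.
move=> GG; rewrite /char_poly /char_poly_mx.
have -> : map_mx polyC (composite_mx w A G) =
    composite_mx (polyC \o w) (map_mx polyC A) G.
  rewrite /composite_mx raddf_sum; apply: eq_bigr => c _ /=.
  by rewrite map_mxZ; congr (_ *: _); apply/matrixP => i j; rewrite !mxE rmorphMn.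
rewrite det_composite_mx ?polyX_eq0 //; congr (_ * _); apply: eq_bigr => c _.
rewrite polyCM polyC_exp /weight rmorph_prod /=; congr (_ - _ * _).
by apply: eq_bigr => i _; rewrite mxE.
Qed.
End CycleMatrix.

(** * Counting and locating real roots of polynomials *)

Section RealRoots.
Variable R : rcfType.
Implicit Types (p q : {poly R}).

Lemma mem_rootsR p x : p != 0 -> (x \in rootsR p) = root p x.
Proof. by move=> p0; rewrite -(roots_on_rootsR p0) in_itv. Qed.

Lemma leq_real_root_count p (s : seq R) :
  p != 0 -> uniq s -> all (root p) s ->
  (size s <= \sum_(x <- rootsR p) mup x p)%N.
Proof.
move=> p0 Us sp; apply: (@leq_trans (size (rootsR p))).
  by apply: uniq_leq_size => // x xs; rewrite mem_rootsR // (allP sp).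
rewrite -sum1_size !big_seq; apply: leq_sum => x.
by rewrite mem_rootsR // -XsubC_dvd // dvdp_XsubCl.
Qed.

(** Without real roots the signs at both infinities agree; they differ by [(-1)] to the degree, and
    the size is the degree plus one. *)
Lemma rootless_odd_size p : (forall x, ~~ root p x) -> odd (size p).
Proof.
move=> pN; have p0 : lead_coef p != 0.
  by rewrite lead_coef_eq0; apply/eqP => p0; have := pN 0; rewrite p0 root0.
have m0 : (0 : R) \in `]-oo, 0] by rewrite in_itv /= lexx.
have i0 : (0 : R) \in `[0, +oo[ by rewrite in_itv /= lexx.
have := sgp_minftyP (fun y _ => pN y) m0; rewrite (sgp_pinftyP (fun y _ => pN y) i0).
have : (0 < size p)%N by rewrite size_poly_gt0 -lead_coef_eq0.
rewrite /sgp_minfty /sgp_pinfty -signr_odd; case: (size p) => //= k _.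
case: (odd k) => //= /eqP; rewrite mulN1r sgrN.
by rewrite -subr_eq0 opprK -mulr2n mulrn_eq0 sgr_eq0 (negbTE p0).
Qed.

(** Real roots are split off one at a time, by induction on the size. The clause on [q] is
    conditional because [p = 0] is given the cofactor [0]. *)
Lemma factor_real_roots p : exists s q,
  p = \prod_(x <- s) ('X - x%:P) * q /\ forall x, p != 0 -> ~~ root q x.
Proof.
have [m] := ubnP (size p); elim: m => // m IH in p *.
rewrite ltnS => pm; have [->|p0] := eqVneq p 0.
  by exists [::], 0; rewrite mulr0.
case Er: (rootsR p) => [|x r].
  exists [::], p; rewrite big_nil mul1r; split=> // x _.
  by rewrite -mem_rootsR // Er.
have : root p x by rewrite -mem_rootsR // Er mem_head.
case/factor_theorem => q pE.
have q0 : q != 0 by apply: contraNneq p0; rewrite pE => ->; rewrite mul0r.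
have [|s [q' [qE qN]]] := IH q.
  by move: pm; rewrite pE size_Mmonic ?monicXsubC // size_XsubC addn2.
exists (x :: s), q'; rewrite big_cons pE {1}qE; split=> [|y _]; first by rewrite mulrC mulrA.
exact: qN.
Qed.

(** Once the real linear factors are removed, the cofactor has no real root, hence even degree. *)
Lemma odd_real_root_count p :
  p != 0 -> odd (\sum_(x <- rootsR p) mup x p) = odd (size p).-1.
Proof.
move=> p0; have [s [q [pE /(_ _ p0) qN]]] := factor_real_roots p.
have q0 : q != 0 by apply: contraNneq p0; rewrite pE => ->; rewrite mulr0.
have -> : (\sum_(x <- rootsR p) mup x p = size s)%N.
  (* Double counting: the multiplicity of [x] is its number of occurrences in [s], and each [y] in
     [s] equals exactly one entry of [rootsR p]. *)
  rewrite (eq_bigr (fun x => \sum_(y <- s) (y == x))%N) => [|x _]; last first.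
    by rewrite pE mupMl // mu_prod_XsubC -sum1_count big_mkcond.
  rewrite exchange_big -sum1_size /= big_seq [RHS]big_seq; apply: eq_bigr => y ys.
  rewrite -big_mkcond /= sum1_count (eq_count (a2 := pred1 y)) => [|x /=]; last exact: eq_sym.
  rewrite count_uniq_mem ?uniq_roots // mem_rootsR // pE rootM.
  by rewrite root_prod_XsubC ys.
have : odd (size q) by apply: rootless_odd_size.
rewrite pE mulrC size_Mmonic ?monic_prod_XsubC // size_prod_XsubC addnS /=.
by case: (size q) => //= m; rewrite oddD => /negbTE->.
Qed.

(** The intermediate value theorem gives roots strictly inside the intervals, so these may share
    endpoints. The scale [s] will be the sign of a cycle and lets the positive and negative cases
    share the same test points. *)
Lemma three_sign_changes p (s a1 b1 a2 b2 a3 b3 : R) :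
  s != 0 -> a1 < b1 -> b1 <= a2 -> a2 < b2 -> b2 <= a3 -> a3 < b3 ->
  p.[s * a1] * p.[s * b1] < 0 -> p.[s * a2] * p.[s * b2] < 0 ->
  p.[s * a3] * p.[s * b3] < 0 ->
  exists2 r, uniq r /\ size r = 3%N & all (root p) r.
Proof.
move=> s0 ab1 ba1 ab2 ba2 ab3 p1 p2 p3.
have E y : p.[s * y] = (p \Po (s *: 'X)).[y] by rewrite horner_comp hornerZ hornerX.
have ivt a b : a < b -> p.[s * a] * p.[s * b] < 0 ->
    exists x, [/\ a < x, x < b & root p (s * x)].
  rewrite !E => /ltW ab /(poly_ivtoo ab)[x]; rewrite in_itv /= => /andP[ax xb].
  by rewrite /root -E => rx; exists x.
have [x1 [ax1 xb1 r1]] := ivt _ _ ab1 p1.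
have [x2 [ax2 xb2 r2]] := ivt _ _ ab2 p2.
have [x3 [ax3 xb3 r3]] := ivt _ _ ab3 p3.
exists [:: s * x1; s * x2; s * x3]; last by rewrite /= r1 r2 r3.
have x12 : x1 < x2 by apply: (lt_trans xb1); apply: le_lt_trans ax2.
have x23 : x2 < x3 by apply: (lt_trans xb2); apply: le_lt_trans ax3.
split=> //=; rewrite !inE !(inj_eq (mulfI s0)) andbT negb_or.
by rewrite !lt_eqF // (lt_trans x12).
Qed.
End RealRoots.

(** * Perturbing a subpattern into the qualitative class *)

Section Perturbation.
Variables (R : realType) (n : nat).
Implicit Types (A B : 'M[R]_n) (P : 'M[sign]_n).

Lemma horner_char_poly (T : comNzRingType) (A : 'M[T]_n) (x : T) :
  (char_poly A).[x] = \det (x%:M - A).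
Proof.
rewrite /char_poly -horner_evalE -det_map_mx; congr (\det _).
by apply/matrixP => i j; rewrite !mxE /= horner_evalE hornerD hornerN hornerC hornerMn hornerX.
Qed.

Lemma norm_prod_le (I : Type) (r : seq I) (F : I -> R) (K : R) :
  (forall i, `|F i| <= K) -> `|\prod_(i <- r) F i| <= K ^+ size r.
Proof.
move=> FK; elim: r => [|i r IH]; first by rewrite big_nil normr1.
by rewrite big_cons normrM exprS ler_pM.
Qed.

(** Telescoping: one factor is exchanged at a time, at cost at most [t] times a power of [K]. *)
Lemma prod_lipschitz (I : Type) (r : seq I) (F F' : I -> R) (K t : R) :
  1 <= K -> 0 <= t -> (forall i, `|F i| <= K) -> (forall i, `|F' i| <= K) ->
  (forall i, `|F i - F' i| <= t) ->
  `|\prod_(i <- r) F i - \prod_(i <- r) F' i| <= (size r)%:R * K ^+ size r * t.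
Proof.
move=> K1 t0 FK FK' Ft; have K0 : 0 <= K by apply: le_trans K1.
elim: r => [|i r IH]; first by rewrite !big_nil subrr normr0 !mul0r.
rewrite !big_cons.
have -> : F i * \prod_(j <- r) F j - F' i * \prod_(j <- r) F' j =
    F i * (\prod_(j <- r) F j - \prod_(j <- r) F' j) + (F i - F' i) * \prod_(j <- r) F' j.
  by ring.
apply: le_trans (ler_normD _ _) _; rewrite !normrM.
have -> : (size (i :: r))%:R * K ^+ size (i :: r) * t =
    K * ((size r)%:R * K ^+ size r * t) + t * (K ^+ size r * K).
  by rewrite /= -natr1 exprS; ring.
apply: lerD; apply: ler_pM => //.
apply: le_trans (norm_prod_le r FK') _.
by rewrite ler_peMr ?exprn_ge0.
Qed.

Lemma det_lipschitz (K t : R) A B :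
  1 <= K -> 0 <= t -> (forall i j, `|A i j| <= K) -> (forall i j, `|B i j| <= K) ->
  (forall i j, `|A i j - B i j| <= t) ->
  `|\det A - \det B| <= (n`! * n)%:R * K ^+ n * t.
Proof.
move=> K1 t0 AK BK ABt; rewrite /determinant -sumrB.
apply: le_trans (ler_norm_sum _ _ _) _.
apply: (@le_trans _ _ (\sum_(s : 'S_n) n%:R * K ^+ n * t)).
  apply: ler_sum => s _; rewrite -mulrBr normrM normr_sign mul1r.
  have := @prod_lipschitz _ (index_enum 'I_n) (fun i => A i (s i)) (fun i => B i (s i)) K t.
  have -> : size (index_enum 'I_n) = n by rewrite /index_enum -enumT size_enum_ord.
  exact.
by rewrite sumr_const card_Sn -[X in X <= _]mulr_natl natrM !mulrA.
Qed.

(** The eigenvector equation is read at a coordinate of largest absolute value. The bound confines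
    the real roots of all small perturbations to one interval. *)
Lemma char_poly_root_norm (C : R) A x :
  (forall i j, `|A i j| <= C) -> root (char_poly A) x -> `|x| <= n%:R * C.
Proof.
move=> AC; rewrite -eigenvalue_root_char => /eigenvalueP[v vA v0].
have /rV0Pn[i0 vi0] := v0.
have [j _ jmax] := @arg_maxP _ _ _ i0 xpredT (fun j => `|v 0 j|) isT.
have vj : 0 < `|v 0 j| by apply: lt_le_trans (jmax i0 isT); rewrite normr_gt0.
rewrite -(ler_pM2r vj) -normrM.
have := congr1 (fun u : 'rV_n => u 0 j) vA; rewrite !mxE => <-.
apply: le_trans (ler_norm_sum _ _ _) _.
apply: (@le_trans _ _ (\sum_(k < n) C * `|v 0 j|)).
  by apply: ler_sum => k _; rewrite normrM mulrC ler_pM //; apply: jmax.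
by rewrite sumr_const card_ord -[leLHS]mulr_natl mulrA.
Qed.

Definition sgn_mx P : 'M[R]_n := \matrix_(i, j) (sign_int (P i j))%:~R.

(** Entrywise this is the closure of the qualitative class: entries may vanish where [P] does not,
    but never have the wrong sign. *)
Definition subpattern P B := forall i j, exists2 w, 0 <= w & B i j = w * sgn_mx P i j.

Lemma qual_class_perturb P B t :
  subpattern P B -> 0 < t -> qual_class P (B + t *: sgn_mx P).
Proof.
move=> PB t0 i j; have [w w0 Bij] := PB i j.
rewrite !mxE Bij mxE -mulrDl sgzM gtr0_sgz ?ltr_wpDl // mul1r sgz_int.
by case: (P i j).
Qed.

Lemma qual_class_sgn_mx P : qual_class P (sgn_mx P).
Proof. by move=> i j; rewrite mxE sgz_int; case: (P i j). Qed.

Lemma perturbE P B t i j : (B + t *: sgn_mx P) i j = B i j + t * sgn_mx P i j.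
Proof. by rewrite mxE [(t *: sgn_mx P) i j]mxE. Qed.

Lemma norm_sgn_mx P i j : `|sgn_mx P i j| <= 1.
Proof. by rewrite mxE; case: (P i j); rewrite ?normr0 ?normrN ?normr1. Qed.

Lemma norm_perturb P t i j : 0 <= t <= 1 -> `|t * sgn_mx P i j| <= t.
Proof. by case/andP=> t0 _; rewrite normrM ger0_norm // ler_piMr // norm_sgn_mx. Qed.

Lemma norm_entry_le B i j : `|B i j| <= \sum_k \sum_l `|B k l|.
Proof.
rewrite (bigD1 i) //= (bigD1 j) //= -addrA lerDl addr_ge0 ?sumr_ge0 // => k _.
exact: sumr_ge0.
Qed.

(** The point is uniformity: [L] depends neither on [t] nor on [x] in the range considered. *)
Lemma char_poly_perturb P B (M : R) : exists2 L, 0 <= L &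
  forall t x, 0 <= t <= 1 -> `|x| <= M ->
  `|(char_poly (B + t *: sgn_mx P)).[x] - (char_poly B).[x]| <= L * t.
Proof.
set C := \sum_i \sum_j `|B i j|.
have C0 : 0 <= C by do 2![apply: sumr_ge0 => ? _].
(* [|M|] covers the scalar part, [C + 1] the entries of [B] and of its perturbation for [t <= 1],
   and the last [1] ensures [1 <= K]. *)
set K := `|M| + (C + 1) + 1.
have K1 : 1 <= K by rewrite lerDr !addr_ge0.
exists ((n`! * n)%:R * K ^+ n) => [|t x t01 xM].
  by rewrite mulr_ge0 // exprn_ge0 // (le_trans _ K1).
have tS i j := norm_perturb P i j t01; have /andP[t0 t1] := t01.
have xK i j : `|x%:M i j| <= `|M|.
  rewrite mxE; case: (i == j); rewrite ?normr0 // mulr1n.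
  by rewrite (le_trans xM) // ler_norm.
have XE A i j : (x%:M - A) i j = x%:M i j - A i j by rewrite mxE [(- A) i j]mxE.
rewrite !horner_char_poly; apply: det_lipschitz => // i j; rewrite !XE ?perturbE.
- apply: le_trans (ler_normB _ _) _; rewrite /K -addrA lerD ?xK //.
  apply: le_trans (ler_normD _ _) _; rewrite -addrA lerD ?norm_entry_le //.
  by rewrite (le_trans (tS i j)) // (le_trans t1) // lerDl.
- apply: le_trans (ler_normB _ _) _.
  by rewrite /K -!addrA lerD ?xK // (le_trans (norm_entry_le B i j)) // lerDl addr_ge0.
- by rewrite -normrN (_ : - _ = t * sgn_mx P i j) //; ring.
Qed.

(** On a finite list the nonzero values stay at distance at least some [m > 0] from zero, so a
    perturbation that changes them by less than [m] keeps their signs. *)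
Lemma char_poly_same_signs P B (s : seq R) :
  subpattern P B -> {in s, forall x, (char_poly B).[x] != 0} ->
  exists2 A, qual_class P A & {in s, forall x, 0 < (char_poly A).[x] * (char_poly B).[x]}.
Proof.
move=> PB sB.
have [m m0 ms] : exists2 m, 0 < m & {in s, forall x, m <= `|(char_poly B).[x]|}.
  elim: s sB => [|x s IH] sB; first by exists 1.
  have [|m m0 ms] := IH; first by move=> y ys; apply: sB; rewrite inE ys orbT.
  have Bx : 0 < `|(char_poly B).[x]| by rewrite normr_gt0 sB ?mem_head.
  exists (Num.min m `|(char_poly B).[x]|); first by rewrite lt_min m0.
  by move=> y; rewrite inE => /predU1P[->|/ms my]; rewrite ge_min ?lexx ?orbT // my.
have [M Ms] : exists M, {in s, forall x, `|x| <= M}.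
  exists (\sum_(x <- s) `|x|) => x xs; rewrite (big_rem x) //= lerDl.
  exact: sumr_ge0.
have [L L0 LP] := char_poly_perturb P B M.
(* [L + 1] keeps the denominator positive when [L = 0]; the bound then gives [L * t < m]. *)
pose t := Num.min 1 (m / (2 * (L + 1))).
have L1 : 0 < 2 * (L + 1) by rewrite mulr_gt0 // ltr_wpDl.
have t0 : 0 < t by rewrite lt_min ltr01 divr_gt0.
exists (B + t *: sgn_mx P); first exact: qual_class_perturb.
move=> x xs; have := LP t x; rewrite ltW //= ge_min lexx Ms // => /(_ isT isT).
have Lt : L * t < m.
  have : t <= m / (2 * (L + 1)) by rewrite ge_min lexx orbT.
  rewrite ler_pdivlMr // => tm; nra.
move=> /le_lt_trans/(_ Lt)/lt_le_trans/(_ (ms x xs)).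
move: (_.[x]) (_.[x]) => b a; rewrite ltr_norml; case: (ler0P b) => b0 /andP[? ?].
  by rewrite nmulr_lgt0; lra.
by rewrite pmulr_lgt0; lra.
Qed.

(** Any root of the perturbed polynomial lies in a fixed bounded interval, and there the value moves
    by less than [1]. *)
Lemma qual_class_no_real_root P B :
  subpattern P B -> (forall x, 1 <= (char_poly B).[x]) ->
  exists2 A : 'M[R]_n, qual_class P A & forall x, ~~ root (char_poly A) x.
Proof.
move=> PB B1; set C := \sum_i \sum_j `|B i j|.
have [L L0 LP] := char_poly_perturb P B (n%:R * (C + 1)).
pose t := (L + 1)^-1.
have t0 : 0 < t by rewrite invr_gt0 ltr_wpDl.
have t1 : t <= 1 by rewrite invf_le1 ?lerDr // ltr_wpDl.
have Lt : L * t < 1 by rewrite ltr_pdivrMr ?mul1r ?ltrDl // ltr_wpDl.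
exists (B + t *: sgn_mx P); first exact: qual_class_perturb.
move=> x; apply/negP => rx.
have xM : `|x| <= n%:R * (C + 1).
  apply: char_poly_root_norm rx => i j; rewrite perturbE (le_trans (ler_normD _ _)) //.
  by rewrite lerD ?norm_entry_le // (le_trans (norm_perturb _ _ _ _)) // ltW.
have := LP t x; rewrite ltW // t1 => /(_ isT xM); rewrite (rootP rx).
have := B1 x; move: (_.[x]) => b b1; rewrite sub0r normrN ger0_norm; lra.
Qed.

(** The qualitative class is convex and the determinant is polynomial along a segment, so a change
    of sign would produce a singular matrix in the class. *)
Lemma det_qual_class_sign P A A' :
  sign_nonsingular R P -> qual_class P A -> qual_class P A' -> 0 < \det A * \det A'.
Proof.
move=> PN PA PA'; rewrite ltNge; apply/negP => dA.
pose p := \det (map_mx polyC A + 'X *: map_mx polyC (A' - A)).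
have pE t : p.[t] = \det (A + t *: (A' - A)).
  rewrite /p -horner_evalE -det_map_mx; congr (\det _).
  by apply/matrixP => i j; rewrite !mxE /= horner_evalE hornerD hornerM hornerX !hornerC.
have [|t] := polyrcf.poly_ivt ler01 (p := p).
  by rewrite !pE scale0r scale1r addr0 (addrC A) subrK.
rewrite in_itv /= => /andP[t0 t1] /rootP; rewrite pE => d0.
suff /PN : qual_class P (A + t *: (A' - A)) by rewrite unitmxE unitfE d0 eqxx.
move=> i j; rewrite !mxE; have := PA i j; have := PA' i j.
move: (A i j) (A' i j) => a a'; case: (P i j) => /eqP + /eqP.
- rewrite !sgz_cp0 => a0 a0'; apply/eqP; rewrite sgz_cp0; nra.
- rewrite !sgz_cp0 => a0 a0'; apply/eqP; rewrite sgz_cp0; nra.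
- by rewrite !sgz_cp0 => /eqP-> /eqP->; rewrite subr0 mulr0 addr0 sgz0.
Qed.
End Perturbation.

(** * Composite cycles of the digraph and the signs they impose *)

Section CompositeCycles.
Variables (R : realType) (n : nat) (P : 'M[sign]_n).
Implicit Types (c d : seq 'I_n) (G : seq (seq 'I_n)).
Local Notation S := (sgn_mx R P).
Local Notation sgc c := ((cycle_sign P c)%:~R : R).

Lemma simple_cycleP (e : rel 'I_n) c :
  simple_cycle e c -> [/\ c != [::], uniq c & {in c, forall i, e i (next c i)}].
Proof. by case/and3P=> c0 ec Uc; split=> // i; apply: next_cycle. Qed.

Lemma size_simple_cycle (e : rel 'I_n) c : simple_cycle e c -> (0 < size c)%N.
Proof. by case/simple_cycleP; case: c. Qed.

Lemma cycle_sign_sqr c : simple_cycle (digraph P) c -> cycle_sign P c ^+ 2 = 1.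
Proof.
case/simple_cycleP=> _ _ Pc; rewrite exprMn sqrr_sign mul1r.
rewrite -prodrXl big_seq big1 // => i /Pc; rewrite /digraph /=.
by case: (P i _).
Qed.

Lemma cycle_sign_pm c : simple_cycle (digraph P) c ->
  cycle_sign P c = 1 \/ cycle_sign P c = -1.
Proof. by move/cycle_sign_sqr/eqP; rewrite sqrf_eq1 => /orP[]/eqP; [left|right]. Qed.

Lemma composite_sign_sqr G : composite_cycle (digraph P) G -> composite_sign P G ^+ 2 = 1.
Proof.
case/andP=> /allP Gc _; rewrite -prodrXl big_seq big1 // => c /Gc.
exact: cycle_sign_sqr.
Qed.

Lemma weight_sgn_mx c : weight S c = (-1) ^+ (size c).-1 * sgc c.
Proof.
rewrite /cycle_sign rmorphM rmorphXn rmorphN1 mulrA -expr2 sqrr_sign mul1r rmorph_prod.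
by apply: eq_bigr => i _; rewrite mxE.
Qed.

Lemma composite_disjoint G : composite_cycle (digraph P) G -> disjoint_cycles G.
Proof.
case/andP=> Gc Gd; rewrite /disjoint_cycles Gd andbT.
by apply: sub_all Gc => c /simple_cycleP[-> ->].
Qed.

Lemma subpattern_composite (w : seq 'I_n -> R) G :
  (forall c, 0 <= w c) -> subpattern P (composite_mx w S G).
Proof.
move=> w0 i j; exists (\sum_(c <- G) w c *+ ((i \in c) && (j == next c i))).
  by apply: sumr_ge0 => c _; apply: mulrn_wge0.
rewrite summxE mulr_suml; apply: eq_bigr => c _.
by rewrite mxE [cycle_mx _ _ _ _]mxE mulrnAl mulrnAr.
Qed.

(** The factor that [c] contributes to the characteristic polynomial. For [w > 0] its real roots are
    [sgn c * w] if [c] is odd, [w] and [- w] if [c] is even and negative, and none if [c] is even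
    and positive. *)
Definition cycle_value (w : R) c (x : R) : R := x ^+ size c + sgc c * (- w) ^+ size c.

Definition cycle_poly (w : R) c : {poly R} :=
  'X^(size c) - (w ^+ size c * weight S c)%:P.

Lemma horner_cycle_poly w c x :
  simple_cycle (digraph P) c -> (cycle_poly w c).[x] = cycle_value w c x.
Proof.
move/size_simple_cycle=> c0.
rewrite /cycle_poly hornerD hornerN hornerC hornerXn weight_sgn_mx /cycle_value.
by rewrite [(- w) ^+ _]exprNn; case: (size c) c0 => // k _; rewrite !exprS /=; ring.
Qed.

Lemma horner_prod_cycle_poly (w : seq 'I_n -> R) G x : composite_cycle (digraph P) G ->
  (\prod_(c <- G) cycle_poly (w c) c).[x] = \prod_(c <- G) cycle_value (w c) c x.
Proof.
case/andP=> /allP Gc _; rewrite horner_prod big_seq [RHS]big_seq.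
by apply: eq_bigr => c cG; rewrite horner_cycle_poly ?Gc.
Qed.

Lemma char_poly_composite (w : seq 'I_n -> R) G x :
  composite_cycle (digraph P) G ->
  x ^+ composite_length G * (char_poly (composite_mx w S G)).[x] =
  x ^+ n * \prod_(c <- G) cycle_value (w c) c x.
Proof.
move=> GP; have := congr1 (horner_eval x) (char_poly_composite_mx w S (composite_disjoint GP)).
by rewrite /horner_eval !hornerM !hornerXn => ->; rewrite -horner_prod_cycle_poly.
Qed.

Lemma char_poly_composite_full (w : seq 'I_n -> R) G x :
  composite_cycle (digraph P) G -> composite_length G = n ->
  (char_poly (composite_mx w S G)).[x] = \prod_(c <- G) cycle_value (w c) c x.
Proof.
move=> GP Gn; have := char_poly_composite_mx w S (composite_disjoint GP).
have Xn0 : 'X^n != 0 :> {poly R} by rewrite expf_neq0 // polyX_eq0.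
by rewrite Gn => /(mulfI Xn0) ->; rewrite -horner_prod_cycle_poly.
Qed.

(** Both [x ^+ n] and [x ^+ composite_length G] are even powers, so away from [0] the sign of the
    characteristic polynomial is that of the product of cycle factors. *)
Lemma composite_same_signs (w : seq 'I_n -> R) G (s : seq R) :
  ~~ odd n -> composite_cycle (digraph P) G -> ~~ odd (composite_length G) ->
  (forall c, 0 <= w c) ->
  {in s, forall x, x != 0 /\ \prod_(c <- G) cycle_value (w c) c x != 0} ->
  exists2 A : 'M[R]_n, qual_class P A &
    {in s, forall x, 0 < (char_poly A).[x] * \prod_(c <- G) cycle_value (w c) c x}.
Proof.
move=> n_even GP G_even w0 sG.
have even_gt0 (m : nat) (x : R) : ~~ odd m -> x != 0 -> 0 < x ^+ m.
  by move=> m_even x0; rewrite lt_def expf_neq0 // exprn_even_ge0.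
pose B := composite_mx w S G.
have BG x : x \in s ->
    0 < (char_poly B).[x] * \prod_(c <- G) cycle_value (w c) c x.
  case/sG=> x0 F0; rewrite -(pmulr_rgt0 _ (even_gt0 _ x G_even x0)) mulrA.
  rewrite char_poly_composite // -mulrA -expr2.
  by rewrite mulr_gt0 ?even_gt0 // lt_def sqrf_eq0 F0 sqr_ge0.
have [|A PA AB] := @char_poly_same_signs _ _ P B s (subpattern_composite G w0).
  by move=> x /BG; apply: contraTneq => ->; rewrite mul0r ltxx.
exists A => // x xs; have := AB x xs; have := BG x xs.
move: (char_poly A).[x] (char_poly B).[x] (\prod_(c <- G) _) => a b f bf ab.
have b0 : b != 0 by apply: contraTneq bf => ->; rewrite mul0r ltxx.
have b2 : 0 < b ^+ 2 by rewrite exprn_even_gt0 // b0.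
rewrite -(pmulr_rgt0 _ b2) (_ : b ^+ 2 * (a * f) = (a * b) * (b * f)); last by ring.
exact: mulr_gt0.
Qed.

Lemma horner0_char_poly (T : comNzRingType) (A : 'M[T]_n) :
  (char_poly A).[0] = (-1) ^+ n * \det A.
Proof. by rewrite horner_coef0 char_poly_det. Qed.

(** With all weights [1], the characteristic polynomial at [0] is [(-1)^n] times the sign of [G],
    and it is also [(-1)^n] times the determinant. A perturbation into the class keeps this sign,
    which is constant on the class. *)
Lemma det_composite_sign G (A : 'M[R]_n) :
  sign_nonsingular R P -> qual_class P A ->
  composite_cycle (digraph P) G -> composite_length G = n ->
  0 < \det A * (composite_sign P G)%:~R.
Proof.
move=> PN PA GP Gn; pose B := composite_mx (fun=> 1) S G.
have B0 : (char_poly B).[0] = (-1) ^+ n * (composite_sign P G)%:~R.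
  have <- : \prod_(c <- G) (-1) ^+ size c = (-1) ^+ n :> R.
    by rewrite -(big_morph _ (exprD (-1)) (expr0 (-1))) -/(composite_length G) Gn.
  rewrite char_poly_composite_full // rmorph_prod -big_split /= big_seq [RHS]big_seq.
  apply: eq_bigr => c cG; case/andP: GP => /allP/(_ c cG)/size_simple_cycle c0 _.
  by rewrite /cycle_value expr0n eqn0Ngt c0 add0r mulrC.
have sB x : x \in [:: 0] -> (char_poly B).[x] != 0.
  rewrite inE => /eqP->; rewrite B0 mulf_neq0 ?signr_eq0 // intr_eq0.
  by rewrite -sqrf_eq0 composite_sign_sqr.
have [A' PA' /(_ 0 (mem_head _ _))] :=
  char_poly_same_signs (subpattern_composite G (fun=> ler01)) sB.
rewrite B0 horner0_char_poly mulrACA -expr2 sqrr_sign mul1r => A'G.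
have := mulr_gt0 (det_qual_class_sign PN PA PA') A'G.
rewrite -mulrA [X in _ * X]mulrA -expr2 mulrCA pmulr_rgt0 //.
by rewrite lt_def sqrf_eq0 sqr_ge0 -unitfE -unitmxE PN.
Qed.

Lemma uniq_flatten_disjoint G : disjoint_cycles G -> uniq (flatten G).
Proof.
elim: G => [//|c G IH] /andP[/= /andP[/andP[_ Uc] Gc] /andP[cG Gp]].
rewrite cat_uniq Uc IH ?andbT; last by rewrite /disjoint_cycles Gc.
apply/hasPn => i /flattenP[d dG id] /=.
by apply/negP => ic; have := disjointFr (allP cG d dG) ic; rewrite id.
Qed.

(** The cycle decomposition of [s], with one orbit listed for each canonical representative in
    [froots s]. *)
Lemma orbit_composite (s : 'S_n) : (forall i, digraph P i (s i)) ->
  exists2 G, composite_cycle (digraph P) G & composite_length G = n.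
Proof.
move=> Ps; pose G := [seq orbit s x | x <- enum (froots s)].
have Gsimple : all (simple_cycle (digraph P)) G.
  apply/allP => _ /mapP[x _ ->]; apply/and3P; split; last exact: orbit_uniq.
    by rewrite -size_eq0 size_orbit -lt0n order_gt0.
  apply: (@sub_cycle _ (frel s)); last exact: cycle_orbit perm_inj _.
  by move=> i j /eqP<-.
have Gdisj : pairwise (fun c d => [disjoint c & d]) G.
  rewrite pairwise_map; have := enum_uniq (froots s); rewrite uniq_pairwise.
  apply: (sub_in_pairwise (P := froots s)) => [x y xr yr /= xy|]; last first.
    by apply/allP => x; rewrite mem_enum.
  rewrite disjoint_subset; apply/subsetP => z; rewrite !inE -!fconnect_orbit => xz.
  apply: contra xy => yz; rewrite -(eqP xr) -(eqP yr) root_connect ?(connect_trans xz) //.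
    by rewrite fconnect_sym //; apply: perm_inj.
  exact/fconnect_sym/perm_inj.
exists G; first by rewrite /composite_cycle Gsimple.
have -> : composite_length G = size (flatten G) by rewrite size_flatten sumnE big_map.
rewrite -[RHS]size_enum_ord; apply/perm_size/uniq_perm; rewrite ?enum_uniq //.
  by apply: uniq_flatten_disjoint; apply: composite_disjoint; rewrite /composite_cycle Gsimple.
move=> x; rewrite mem_enum inE; apply/flattenP; exists (orbit s (fingraph.root (frel s) x)).
  by rewrite map_f // mem_enum; apply/roots_root/fconnect_sym/perm_inj.
rewrite -fconnect_orbit fconnect_sym; [exact: connect_root | exact: perm_inj].
Qed.

(** A nonzero determinant has a nonzero Leibniz term, whose permutation follows arcs only. *)
Lemma exists_composite : sign_nonsingular R P ->
  exists2 G, composite_cycle (digraph P) G & composite_length G = n.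
Proof.
move=> PN; have : \det S != 0 by rewrite -unitfE -unitmxE PN //; apply: qual_class_sgn_mx.
have [s ds _|dS] := pickP (fun s : 'S_n => \prod_i S i (s i) != 0); last first.
  by rewrite /determinant big1 ?eqxx // => s _; rewrite (eqP (negbFE (dS s))) mulr0.
apply: (@orbit_composite s) => i; apply: contraNneq ds => dP.
by rewrite /= (bigD1 i) //= mxE dP mul0r.
Qed.
End CompositeCycles.

(** Here [a] has the sign of [s * q], hence that of [s * k], while [b] has the opposite sign. *)
Lemma opposite_signs_shared_factor (R : realFieldType) (a b s u q k : R) :
  0 < a * (s * u * q) -> 0 < u -> 0 < q * k -> b * s * k < 0 -> a * b < 0.
Proof.
move=> aq u0 qk bk.
have q0 : q != 0 by apply: contraTneq qk => ->; rewrite mul0r ltxx.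
have sk0 : s * k != 0 by apply: contraTneq bk; rewrite -mulrA => ->; rewrite mulr0 ltxx.
have uq : 0 < u * q ^+ 2 by rewrite mulr_gt0 // exprn_even_gt0 //= q0.
have ak : 0 < a * s * k.
  rewrite -(pmulr_lgt0 _ uq).
  have -> : a * s * k * (u * q ^+ 2) = a * (s * u * q) * (q * k) by ring.
  exact: mulr_gt0.
have sk : 0 < (s * k) ^+ 2 by rewrite exprn_even_gt0 //= sk0.
rewrite -(pmulr_llt0 _ sk).
have -> : a * b * (s * k) ^+ 2 = a * s * k * (b * s * k) by ring.
by rewrite pmulr_rlt0.
Qed.

(** The common factor [s] enters [a * b] squared, so the sign is that of [u * v * (q * r)]. *)
Lemma opposite_signs_of_factors (R : realFieldType) (a b s u v q r : R) :
  0 < a * (s * u * q) -> 0 < b * (s * v * r) -> u * v < 0 -> 0 < q * r -> a * b < 0.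
Proof.
move=> aq br uv qr; have s0 : s != 0.
  by apply: contraTneq aq => ->; rewrite !mul0r mulr0 ltxx.
have uvqr : s ^+ 2 * (u * v * (q * r)) < 0.
  by rewrite pmulr_rlt0 ?exprn_even_gt0 //= ?s0 // nmulr_rlt0.
rewrite -(nmulr_lgt0 _ uvqr).
have -> : a * b * (s ^+ 2 * (u * v * (q * r))) = a * (s * u * q) * (b * (s * v * r)).
  by ring.
exact: mulr_gt0.
Qed.

(** * Consequences of having exactly two real eigenvalues *)

Section SignPatternsInDelta.
Variables (R : realType) (n : nat) (P : 'M[sign]_n).
Hypotheses (PN : sign_nonsingular R P) (PD : in_Delta R P).
Implicit Types (A : 'M[R]_n) (c d : seq 'I_n) (G : seq (seq 'I_n)).

Lemma char_poly_neq0 A : char_poly A != 0.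
Proof. exact/monic_neq0/char_poly_monic. Qed.

(** The number of real roots, here two, has the parity of the degree [n]. *)
Lemma Delta_even : ~~ odd n.
Proof.
have := odd_real_root_count (char_poly_neq0 (sgn_mx R P)).
by rewrite size_char_poly [X in odd X](PD (qual_class_sgn_mx _ _)) /= => <-.
Qed.

Lemma Delta_sign_changes A (s a1 b1 a2 b2 a3 b3 : R) :
  qual_class P A -> s != 0 ->
  [/\ a1 < b1, b1 <= a2, a2 < b2, b2 <= a3 & a3 < b3] ->
  let p := char_poly A in
  ~ [/\ p.[s * a1] * p.[s * b1] < 0, p.[s * a2] * p.[s * b2] < 0
      & p.[s * a3] * p.[s * b3] < 0].
Proof.
move=> PA s0 [ab1 ba1 ab2 ba2 ab3] p [p1 p2 p3].
have [r [Ur r3] /(leq_real_root_count (char_poly_neq0 A) Ur)] :=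
  three_sign_changes s0 ab1 ba1 ab2 ba2 ab3 p1 p2 p3.
by rewrite r3 [X in (_ <= X)%N](PD PA).
Qed.

Lemma Delta_char_poly0 A : (char_poly A).[0] = \det A.
Proof. by rewrite horner0_char_poly -signr_odd (negbTE Delta_even) mul1r. Qed.

Lemma qual_class_det_neq0 A : qual_class P A -> \det A != 0.
Proof. by move=> PA; rewrite -unitfE -unitmxE PN. Qed.

(** The cycle alone, with weight [1], gives [x^k - 1], positive at [-2] and negative at [-1/2] and
    [1/2]. A positive determinant would make the value at [0] positive, giving three sign
    changes. *)
Lemma negative_even_cycle_det c A :
  negative_even_cycle P c -> qual_class P A -> \det A < 0.
Proof.
case/and3P=> Pc c_even /eqP sc PA; have c0 := size_simple_cycle Pc.
have k0 : size c != 0%N by rewrite -lt0n.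
have val x : \prod_(d <- [:: c]) cycle_value P 1 d x = x ^+ size c - 1 :> R.
  by rewrite big_seq1 /cycle_value sc mulN1r -signr_odd (negbTE c_even).
have sqrN x : (- x) ^+ size c = x ^+ size c :> R.
  by rewrite exprNn -signr_odd (negbTE c_even) mul1r.
have big : 1 < 2 ^+ size c :> R by rewrite exprn_egt1 // ltr1n.
have small : 2^-1 ^+ size c < 1 :> R.
  by rewrite exprn_ilt1 // ?invr_ge0 // invf_lt1 // ltr1n.
have [|||||A' PA' A'c] := @composite_same_signs R n P (fun=> 1) [:: c] [:: -2; - 2^-1; 2^-1].
- exact: Delta_even.
- by rewrite /composite_cycle /= Pc.
- by rewrite /composite_length big_seq1.
- by [].
- move=> x; rewrite !inE val => /or3P[]/eqP->; rewrite ?sqrN ?oppr_eq0 ?invr_eq0 pnatr_eq0 subr_eq0;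
  split=> //; rewrite ?(gt_eqF big) ?(lt_eqF small) //.
have r1 : 0 < (char_poly A').[-2].
  by have := A'c (-2); rewrite !inE eqxx val sqrN pmulr_lgt0 ?subr_gt0 //; apply.
have r2 : (char_poly A').[- 2^-1] < 0.
  by have := A'c (- 2^-1); rewrite !inE eqxx orbT val sqrN nmulr_lgt0 ?subr_lt0 //; apply.
have r3 : (char_poly A').[2^-1] < 0.
  by have := A'c 2^-1; rewrite !inE eqxx !orbT val nmulr_lgt0 ?subr_lt0 //; apply.
have := det_qual_class_sign PN PA PA'.
suff dA' : \det A' < 0 by rewrite nmulr_lgt0.
rewrite lt_neqAle qual_class_det_neq0 // leNgt; apply/negP => dA'.
apply: (@Delta_sign_changes A' 1 (-2) (- 2^-1) (- 2^-1) 0 0 2^-1) => //.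
  exact: oner_neq0.
  by split; lra.
by rewrite !mul1r Delta_char_poly0; split; nra.
Qed.

(** With weights [1] and [3] on the two cycles and [x = s * y], where [s] is their common sign, the
    product changes sign at [y = 1] and at [y = 3]. A negative determinant would add a change
    between [0] and [1/2]. *)
Lemma odd_cycles_det c d A :
  odd_cycle (digraph P) c -> odd_cycle (digraph P) d -> [disjoint c & d] ->
  cycle_sign P c = cycle_sign P d -> qual_class P A -> 0 < \det A.
Proof.
move=> /andP[Pc c_odd] /andP[Pd d_odd] cd scd PA.
pose s : R := (cycle_sign P c)%:~R.
have s2 : s ^+ 2 = 1 by rewrite -rmorphXn /= cycle_sign_sqr.
have sX k : odd k -> s ^+ k = s.
  by rewrite /s; case: (cycle_sign_pm Pc) => -> k_odd;
    rewrite ?rmorphN1 ?expr1n // -signr_odd k_odd.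
have dNc : d != c.
  apply/eqP => E; have := cd; rewrite E -[[disjoint _ & _]]negbK.
  by case: (c) (size_simple_cycle Pc) => // i e _; rewrite (disjoint_has) /= mem_head.
pose w e : R := if e == c then 1 else 3.
have val y : \prod_(e <- [:: c; d]) cycle_value P (w e) e (s * y) =
    (y ^+ size c - 1) * (y ^+ size d - 3 ^+ size d).
  rewrite big_cons big_seq1 /cycle_value /w eqxx (negbTE dNc) -scd -/s.
  rewrite !exprMn !sX // [(- 3) ^+ _]exprNn -[(-1) ^+ size c]signr_odd.
  rewrite -[(-1) ^+ size d]signr_odd c_odd d_odd expr1.
  transitivity (s ^+ 2 * ((y ^+ size c - 1) * (y ^+ size d - 3 ^+ size d))); first by ring.
  by rewrite s2 mul1r.
have s0 : s != 0 by rewrite -sqrf_eq0 s2 oner_eq0.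
have c0 : size c != 0%N by rewrite -lt0n (size_simple_cycle Pc).
have d0 : size d != 0%N by rewrite -lt0n (size_simple_cycle Pd).
have pow_lt (a b : R) k : k != 0%N -> 0 <= a -> a < b -> a ^+ k < b ^+ k.
  by move=> k0 a0 ab; rewrite ltrXn2r ?k0 //.
have v1 : 0 < (2^-1 ^+ size c - 1) * (2^-1 ^+ size d - 3 ^+ size d) :> R.
  by rewrite nmulr_rgt0 subr_lt0 -?[ltRHS](expr1n _ (size c)) pow_lt //; lra.
have v2 : (2 ^+ size c - 1) * (2 ^+ size d - 3 ^+ size d) < 0 :> R.
  by rewrite pmulr_rlt0 ?subr_gt0 ?subr_lt0 -?[ltLHS](expr1n _ (size c)) pow_lt //; lra.
have v3 : 0 < (4 ^+ size c - 1) * (4 ^+ size d - 3 ^+ size d) :> R.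
  by rewrite pmulr_rgt0 subr_gt0 -?[ltLHS](expr1n _ (size c)) pow_lt //; lra.
have [|||||A' PA' A'cd] :=
  @composite_same_signs R n P w [:: c; d] [:: s * 2^-1; s * 2; s * 4].
- exact: Delta_even.
- by rewrite /composite_cycle /= Pc Pd cd.
- by rewrite /composite_length big_cons big_seq1 oddD c_odd d_odd.
- by move=> e; rewrite /w; case: eqP.
- move=> x; rewrite !inE => /or3P[]/eqP->; rewrite val.
  + by split; [rewrite mulf_neq0 ?invr_eq0 ?pnatr_eq0 | rewrite (gt_eqF v1)].
  + by split; [rewrite mulf_neq0 ?invr_eq0 ?pnatr_eq0 | rewrite (lt_eqF v2)].
  + by split; [rewrite mulf_neq0 ?invr_eq0 ?pnatr_eq0 | rewrite (gt_eqF v3)].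
have r1 : 0 < (char_poly A').[s * 2^-1].
  by have := A'cd (s * 2^-1); rewrite !inE eqxx val pmulr_lgt0 //; apply.
have r2 : (char_poly A').[s * 2] < 0.
  by have := A'cd (s * 2); rewrite !inE eqxx orbT val nmulr_lgt0 //; apply.
have r3 : 0 < (char_poly A').[s * 4].
  by have := A'cd (s * 4); rewrite !inE eqxx !orbT val pmulr_lgt0 //; apply.
have := det_qual_class_sign PN PA PA'.
suff dA' : 0 < \det A' by rewrite pmulr_lgt0.
rewrite lt_def qual_class_det_neq0 // leNgt; apply/negP => dA'.
apply: (@Delta_sign_changes A' s 0 2^-1 2^-1 2 2 4) => //.
  by split; lra.
by rewrite mulr0 Delta_char_poly0; split; nra.
Qed.

Lemma disjoint_rem G c d :
  pairwise (fun c d => [disjoint c & d]) G -> c \in G -> d \in rem c G -> [disjoint c & d].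
Proof.
elim: G => [//|e G IH] /= /andP[/allP eG Gd]; rewrite inE eq_sym.
have [<- _ /eG //|ec] := eqVneq e c; rewrite inE => /= cG /predU1P[->|]; last exact: IH.
by rewrite disjoint_sym eG.
Qed.

(** A composite cycle of length [n] either has a negative even cycle, or an odd cycle and then a
    second one by parity, or only positive even cycles. In the last case each factor is [x^k + 1],
    which excludes real eigenvalues after perturbation. *)
Lemma Delta_odd_cycles :
  (exists c, negative_even_cycle P c) \/
  (exists c d, [/\ odd_cycle (digraph P) c, odd_cycle (digraph P) d & [disjoint c & d]]).
Proof.
have [G GP Gn] := exists_composite PN; have /andP[/allP Gc Gd] := GP.
have [/hasP[c _ Pc]|/hasPn G_pos] := boolP (has (negative_even_cycle P) G).
  by left; exists c.
have [/hasP[c cG c_odd]|/hasPn G_even] := boolP (has (fun c => odd (size c)) G).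
  right; have Gperm := perm_to_rem cG.
  have [/hasP[d dG d_odd]|/hasPn G_even] := boolP (has (fun c => odd (size c)) (rem c G)).
    exists c, d; rewrite /odd_cycle c_odd d_odd !Gc ?(mem_rem dG) //; split=> //.
    by case: (disjoint_rem Gd cG dG).
  case/negP: Delta_even; rewrite -[X in odd X]Gn /composite_length (perm_big _ Gperm) /=.
  rewrite big_cons oddD c_odd /=.
  rewrite big_seq; elim/big_ind: _ => [//|x y Ex Ey|d /G_even //].
  by rewrite oddD (negbTE Ex) (negbTE Ey).
have B1 x : 1 <= (char_poly (composite_mx (fun=> 1) (sgn_mx R P) G)).[x].
  rewrite char_poly_composite_full //.
  have one_le c : c \in G -> 1 <= cycle_value P 1 c x.
    move=> cG; have := G_pos c cG; rewrite /negative_even_cycle Gc //= G_even //=.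
    case: (cycle_sign_pm (Gc c cG)) => E; rewrite E ?eqxx // => _.
    rewrite /cycle_value E mul1r -[(-1) ^+ _]signr_odd (negbTE (G_even c cG)).
    by rewrite lerDr exprn_even_ge0 ?G_even.
  rewrite big_seq; elim/big_ind: _ => // a b a1 b1.
  by rewrite -[1]mulr1 ler_pM.
have [A PA Aroot] := qual_class_no_real_root (subpattern_composite P G (fun=> ler01)) B1.
have := PD PA; rewrite /num_real_eigenvalues.
case E: (rootsR (char_poly A)) => [|x r]; first by rewrite big_nil.
by case/negP: (Aroot x); rewrite -mem_rootsR ?char_poly_neq0 // E mem_head.
Qed.
(** Inside the unit interval the constant term of absolute value [1] dominates the power. *)
Lemma cycle_value_near0 c (x : R) :
  simple_cycle (digraph P) c -> `|x| < 1 ->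
  0 < cycle_value P 1 c x * ((cycle_sign P c)%:~R * (-1) ^+ size c).
Proof.
move=> Pc x1; have c0 : size c != 0%N by rewrite -lt0n (size_simple_cycle Pc).
have : `|x ^+ size c| < 1 by rewrite normrX exprn_ilt1.
rewrite /cycle_value ltr_norml -[(-1) ^+ _]signr_odd => /andP[xl xu].
by case: (cycle_sign_pm Pc) => ->; case: odd;
  rewrite ?rmorphN1 ?expr0 ?expr1 ?mulrNN ?mulrN1 ?mulr1; lra.
Qed.

(** Outside the unit interval the power dominates, so the sign is constant on each side of it. *)
Lemma cycle_value_far c (x y : R) :
  simple_cycle (digraph P) c -> 1 < `|x| -> 1 < `|y| -> 0 < x * y ->
  0 < cycle_value P 1 c x * cycle_value P 1 c y.
Proof.
move=> Pc x1 y1 xy; have c0 : size c != 0%N by rewrite -lt0n (size_simple_cycle Pc).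
have : 1 < `|x ^+ size c| by rewrite normrX exprn_egt1.
have : 1 < `|y ^+ size c| by rewrite normrX exprn_egt1.
have : 0 < x ^+ size c * y ^+ size c by rewrite -exprMn exprn_gt0.
rewrite /cycle_value !lter_normr; move: (x ^+ _) (y ^+ _) => X Y XY Y1 X1.
have a1 : `|(cycle_sign P c)%:~R * (-1) ^+ size c : R| <= 1.
  by rewrite normrM normrX normrN1 expr1n mulr1; case: (cycle_sign_pm Pc) => ->;
    rewrite ?rmorphN1 ?normrN1 ?normr1.
move: (_%:~R * _) a1 => a; rewrite ler_norml => /andP[al au].
case/orP: X1 => X1; case/orP: Y1 => Y1; nra.
Qed.

(** Suppose the signs differ, and replace [c] by [d] in [G]. With [x = s * y], [s] the sign of [c],
    weight [2] on [d] forces a sign change at [y = -2], beyond the unit interval that holds the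
    roots of the other factors. The determinant is governed by [G], and its sign is opposite to that
    of the values at [y = -1/2] and [y = 1/2], which gives two more changes. *)
Lemma odd_subcycle_sign G c d :
  composite_cycle (digraph P) G -> composite_length G = n -> c \in G ->
  odd_cycle (digraph P) c -> odd_cycle (induced [set i in c] (digraph P)) d ->
  cycle_sign P d = cycle_sign P c.
Proof.
move=> GP Gn cG /andP[Pc c_odd] /andP[Pd' d_odd].
have /andP[/allP Gc Gd] := GP; have [d_neq0 Ud dc] := simple_cycleP Pd'.
have {}Pd' : simple_cycle (digraph P) d.
  have /and3P[_ cyc _] := Pd'; apply/and3P; split=> //.
  by apply: sub_cycle cyc => i j /and3P[].
have d_sub : {subset d <= c} by move=> i /dc /and3P[]; rewrite inE.
have Gperm := perm_to_rem cG; pose H := rem c G.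
have HG e : e \in H -> e \in G by apply: mem_rem.
have dH e : e \in H -> [disjoint d & e].
  by move=> eH; apply: disjointWl (disjoint_rem Gd cG eH); apply/subsetP.
have H_odd : odd (composite_length H).
  have := Delta_even; rewrite -[X in odd X]Gn /composite_length (perm_big _ Gperm) big_cons.
  by rewrite oddD c_odd negbK.
apply/eqP/negPn/negP => dNc.
pose s : R := (cycle_sign P c)%:~R.
have s2 : s ^+ 2 = 1 by rewrite -rmorphXn /= cycle_sign_sqr.
have s0 : s != 0 by rewrite -sqrf_eq0 s2 oner_eq0.
have sd : (cycle_sign P d)%:~R = - s.
  by rewrite /s; move: dNc; case: (cycle_sign_pm Pc) => ->; case: (cycle_sign_pm Pd') => ->;
    rewrite ?eqxx ?rmorphN1 ?opprK.
have sX k : odd k -> s ^+ k = s.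
  by rewrite /s; case: (cycle_sign_pm Pc) => -> k_odd;
    rewrite ?rmorphN1 ?expr1n // -signr_odd k_odd.
have s_norm : `|s| = 1 by rewrite /s; case: (cycle_sign_pm Pc) => ->;
  rewrite ?rmorphN1 ?normrN1 ?normr1.
pose w e : R := if e == d then 2 else 1.
pose Q x : R := \prod_(e <- H) cycle_value P 1 e x.
(* [K] is the product of the constant terms of the remaining factors, which fixes the sign of [Q]
   near [0]. *)
pose K : R := \prod_(e <- H) ((cycle_sign P e)%:~R * (-1) ^+ size e).
have val y : \prod_(e <- d :: H) cycle_value P (w e) e (s * y) =
    s * (y ^+ size d + 2 ^+ size d) * Q (s * y).
  rewrite big_cons; congr (_ * _).
    rewrite /cycle_value /w eqxx sd exprMn sX // exprNn -[(-1) ^+ _]signr_odd d_odd.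
    by rewrite expr1; ring.
  rewrite big_seq /Q [RHS]big_seq; apply: eq_bigr => e eH; rewrite /w.
  (* [d] itself cannot occur in [H], since a nonempty cycle is not disjoint from itself; so weight
     [2] affects one factor only. *)
  case: eqP eH => // -> /dH; case: (d) d_neq0 => // i d' _.
  by rewrite disjoint_has /= mem_head.
have QK x : `|x| < 1 -> 0 < Q x * K.
  move=> x1; rewrite -big_split big_seq; apply: prodr_gt0 => e /HG /Gc Pe.
  exact: cycle_value_near0.
have QQ x y : 1 < `|x| -> 1 < `|y| -> 0 < x * y -> 0 < Q x * Q y.
  move=> x1 y1 xy; rewrite -big_split big_seq; apply: prodr_gt0 => e /HG /Gc Pe.
  exact: cycle_value_far.
(* The determinant has the sign of [G], namely [s] times the signs in [H]; the odd total length of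
   [H] makes [K] the negative of the latter product. *)
have detK A : qual_class P A -> \det A * s * K < 0.
  move=> PA; have := det_composite_sign PN PA GP Gn.
  rewrite /composite_sign (perm_big _ Gperm) big_cons rmorphM rmorph_prod /=.
  rewrite /K big_split /= -(big_morph _ (exprD (-1)) (expr0 (-1))) -/(composite_length H).
  by rewrite -[(-1) ^+ composite_length H]signr_odd H_odd expr1 mulrN1 mulrN oppr_lt0 mulrA.
have d0 : size d != 0%N by rewrite -lt0n (size_simple_cycle Pd').
pose u y : R := y ^+ size d + 2 ^+ size d.
have uN y : u (- y) = 2 ^+ size d - y ^+ size d.
  by rewrite /u exprNn -signr_odd d_odd expr1 mulN1r addrC.
have u1 : u (- 3) < 0 by rewrite uN subr_lt0 ltrXn2r ?d0 //; lra.
have u2 : 0 < u (- (3 / 2)) by rewrite uN subr_gt0 ltrXn2r ?d0 //; lra.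
have u3 : 0 < u (- 2^-1) by rewrite uN subr_gt0 ltrXn2r ?d0 //; lra.
have u4 : 0 < u 2^-1 by rewrite addr_gt0 ?exprn_gt0 //; lra.
have s_far y : 1 < `|y| -> 1 < `|s * y| by rewrite normrM s_norm mul1r.
have s_near y : `|y| < 1 -> `|s * y| < 1 by rewrite normrM s_norm mul1r.
have y1 : 1 < `|- 3 : R| by rewrite normrN ger0_norm; lra.
have y2 : 1 < `|- (3 / 2) : R| by rewrite normrN ger0_norm; lra.
have y3 : `|- 2^-1 : R| < 1 by rewrite normrN ger0_norm; lra.
have y4 : `|2^-1 : R| < 1 by rewrite ger0_norm; lra.
have Q_far y : 1 < `|y| -> Q (s * y) != 0.
  move=> /s_far sy; suff : 0 < Q (s * y) * Q (s * y) by apply: contraTneq => ->; rewrite mul0r ltxx.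
  apply: QQ => //; rewrite -expr2 exprn_even_gt0 //=.
  by rewrite -normr_gt0 (lt_trans ltr01).
have Q_near y : `|y| < 1 -> Q (s * y) != 0.
  by move/s_near/QK; apply: contraTneq => ->; rewrite mul0r ltxx.
have F_neq0 y : u y != 0 -> Q (s * y) != 0 -> s * u y * Q (s * y) != 0.
  by move=> *; rewrite !mulf_neq0.
have [|||||A PA Ad] := @composite_same_signs R n P w (d :: H)
  [:: s * - 3; s * - (3 / 2); s * - 2^-1; s * 2^-1].
- exact: Delta_even.
- apply/andP; split; first by rewrite /= Pd'; apply/allP => e /HG /Gc.
  by rewrite /= (subseq_pairwise (rem_subseq c G) Gd) andbT; apply/allP.
- by rewrite /composite_length big_cons oddD d_odd -/(composite_length H) H_odd.
- by move=> e; rewrite /w; case: eqP.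
- move=> x; rewrite !inE => /or4P[]/eqP->; rewrite val.
  + by split; [apply: mulf_neq0 => //; apply: ltr0_neq0; lra | rewrite F_neq0 ?Q_far // lt_eqF].
  + by split; [apply: mulf_neq0 => //; apply: ltr0_neq0; lra | rewrite F_neq0 ?Q_far // gt_eqF].
  + by split; [apply: mulf_neq0 => //; apply: ltr0_neq0; lra | rewrite F_neq0 ?Q_near // gt_eqF].
  + by split; [apply: mulf_neq0 => //; apply: lt0r_neq0; lra | rewrite F_neq0 ?Q_near // gt_eqF].
have near_flip y : u y > 0 -> `|y| < 1 ->
    0 < (char_poly A).[s * y] * \prod_(e <- d :: H) cycle_value P (w e) e (s * y) ->
    (char_poly A).[s * y] * \det A < 0.
  rewrite val => uy y_1 FA; have := QK _ (s_near y y_1); have := detK A PA.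
  by move=> detA QyK; apply: opposite_signs_shared_factor FA uy QyK detA.
have p1 : (char_poly A).[s * - 3] * (char_poly A).[s * - (3 / 2)] < 0.
  have := Ad (s * - 3); have := Ad (s * - (3 / 2)).
  rewrite !inE !eqxx orbT !val => /(_ isT) F2 /(_ isT) F1.
  have q12 : 0 < Q (s * - 3) * Q (s * - (3 / 2)).
    apply: QQ; rewrite ?s_far // mulrACA -expr2 s2; lra.
  have u12 : u (- 3) * u (- (3 / 2)) < 0 by rewrite nmulr_rlt0.
  exact: opposite_signs_of_factors F1 F2 u12 q12.
have p2 : (char_poly A).[s * - 2^-1] * \det A < 0.
  by apply: near_flip => //; apply: Ad; rewrite !inE eqxx !orbT.
have p3 : (char_poly A).[s * 2^-1] * \det A < 0.
  by apply: near_flip => //; apply: Ad; rewrite !inE eqxx !orbT.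
apply: (@Delta_sign_changes A s (- 3) (- (3 / 2)) (- 2^-1) 0 0 2^-1) => //.
  by split; lra.
by rewrite mulr0 Delta_char_poly0; split; rewrite // mulrC.
Qed.
End SignPatternsInDelta.

Theorem theorem5p12 (R : realType) (n : nat) (P : 'M[sign]_n)
    (hP : sign_nonsingular R P) (hD : in_Delta R P) :
  [/\ (* (1) *)
      forall G H : seq (seq 'I_n),
        composite_cycle (digraph P) G -> composite_length G = n ->
        composite_cycle (digraph P) H -> composite_length H = n ->
        composite_sign P G = composite_sign P H,
      (* (2) *)
      (exists c, negative_even_cycle P c) \/
      (exists c d : seq 'I_n, [/\ odd_cycle (digraph P) c, odd_cycle (digraph P) d
                     & [disjoint c & d]]),
      (* (3) *)
      (exists c, negative_even_cycle P c) ->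
      ~ (exists c d : seq 'I_n, [/\ odd_cycle (digraph P) c, odd_cycle (digraph P) d,
                         [disjoint c & d] & cycle_sign P c = cycle_sign P d])
    & (* (4) *)
      forall (G : seq (seq 'I_n)) (c : seq 'I_n),
        composite_cycle (digraph P) G -> composite_length G = n ->
        c \in G -> odd_cycle (digraph P) c ->
        forall d, odd_cycle (induced [set i in c] (digraph P)) d ->
          cycle_sign P d = cycle_sign P c].
Proof.
split.
(* Both signs are [1] or [-1] and both agree with the sign of one determinant. *)
- move=> G H GP Gn HP Hn; have PS := qual_class_sgn_mx R P.
  have := mulr_gt0 (det_composite_sign hP PS GP Gn) (det_composite_sign hP PS HP Hn).
  have := composite_sign_sqr GP; have := composite_sign_sqr HP.
  move=> /eqP + /eqP; rewrite !sqrf_eq1.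
  have d2 : 0 < (\det (sgn_mx R P)) ^+ 2.
    by rewrite exprn_even_gt0 // (qual_class_det_neq0 hP).
  rewrite mulrACA -expr2 pmulr_rgt0 // -rmorphM ltr0z.
  by move=> /orP[]/eqP-> /orP[]/eqP->.
- exact: Delta_odd_cycles hP hD.
(* The even cycle makes the determinant negative, the two odd cycles make it positive. *)
- move=> [e Pe] [c [d [Pc Pd cd scd]]]; have PS := qual_class_sgn_mx R P.
  have := negative_even_cycle_det hP hD Pe PS.
  by rewrite ltNge ltW // (odd_cycles_det hP hD Pc Pd cd scd PS).
- move=> G c GP Gn cG c_odd d d_odd.
  exact: (odd_subcycle_sign hP hD GP Gn cG c_odd d_odd).
Qed.
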